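(* Let $a<b$ be real numbers. An element $f\in C[a,b]$ is a topological divisor of zero in $C[a,b]$ if and only if $f$ has at least one zero in $[a,b]$, i.e. there exists $c\in[a,b]$ with $f(c)=0$.
   Context: $C[a,b]$ denotes the Banach algebra of all continuous complex-valued functions on the closed interval $[a,b]$, with pointwise operations and the supremum norm. An element $z$ of a Banach algebra $\mathcal{A}$ is called a topological divisor of zero if there exists a sequence $(z_n)_{n=1}^\infty$ in $\mathcal{A}$ such that $\|z_n\|=1$ for all $n\in\mathbb{N}$, and either $zz_n\to 0$ or $z_nz\to 0$ as $n\to\infty$. *)

(* Defs.v *)
From HB Require Import structures.
From mathcomp Require Import all_boot all_order all_algebra.
From mathcomp Require Import complex lra.
From mathcomp Require Import all_classical all_reals all_analysis.

Set Implicit Arguments.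
Unset Strict Implicit.
Unset Printing Implicit Defensive.
Import Order.TTheory GRing.Theory Num.Theory.
Import numFieldNormedType.Exports.
Import ComplexField.Normc.

Local Open Scope classical_set_scope.
Local Open Scope complex_scope.
Local Open Scope ring_scope.

(* Banach algebras are not assumed unital.  The product is a separate operation,
   not that of a MathComp ring: the algebraic and normed hierarchies of MathComp
   provide no common substructure of rings and normed modules. *)
HB.mixin Record CompleteNormedModule_isBanachAlgebra (K : numFieldType) A
    of CompleteNormedModule K A := {
  bmul : A -> A -> A;
  bmulA : associative bmul;
  bmulDl : left_distributive bmul +%R;
  bmulDr : right_distributive bmul +%R;
  bscaleAl : forall (k : K) (x y : A), k *: bmul x y = bmul (k *: x) y;
  bscaleAr : forall (k : K) (x y : A), k *: bmul x y = bmul x (k *: y);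
  normr_bmul_le : forall x y : A, `|bmul x y| <= `|x| * `|y|
}.

#[short(type="banachAlgType")]
HB.structure Definition BanachAlgebra (K : numFieldType) :=
  {A of CompleteNormedModule K A & CompleteNormedModule_isBanachAlgebra K A}.

Definition topological_divisor_of_zero (K : numFieldType)
    (A : banachAlgType K) (z : A) : Prop :=
  exists u : nat -> A, (forall n, `|u n| = 1) /\
    ((bmul z (u n) @[n --> \oo] --> (0 : A)) \/
     (bmul (u n) z @[n --> \oo] --> (0 : A))).

Section ComplexComplete.
Variable R : realType.
Implicit Types (z w : R[i]) (F : set_system R[i]^o).

Lemma normcE0 z : `|z| = (normc z)%:C.
Proof. by []. Qed.

Lemma normc_ge0 z : 0 <= normc z.
Proof. by case: z => x y; rewrite /normc sqrtr_ge0. Qed.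

Lemma normc_triangle z w : normc (z + w) <= normc z + normc w.
Proof. exact: le_normcD. Qed.

Lemma gt0_complexE (e : R[i]) : 0 < e -> exists2 r : R, 0 < r & e = r%:C.
Proof.
case: e => r s; rewrite ltcE /= => /andP[/eqP -> r0]; by exists r.
Qed.

Lemma normc_ge_Re0 z : `|complex.Re z| <= normc z.
Proof.
by case: z => x y /=; rewrite -sqrtr_sqr ler_wsqrtr// lerDl sqr_ge0.
Qed.

Lemma normc_ge_Im z : `|complex.Im z| <= normc z.
Proof.
by case: z => x y /=; rewrite -sqrtr_sqr ler_wsqrtr// lerDr sqr_ge0.
Qed.

Lemma normc_le_ReIm z : normc z <= `|complex.Re z| + `|complex.Im z|.
Proof.
case: z => x y /=.
rewrite -[leRHS]ger0_norm ?addr_ge0// -sqrtr_sqr ler_wsqrtr//.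
rewrite sqrrD -!normrX (ger0_norm (sqr_ge0 x)) (ger0_norm (sqr_ge0 y)).
by rewrite addrAC lerDl mulrn_wge0// mulr_ge0.
Qed.

Lemma cvg_complexP (T : Type) (G : set_system T) (FG : Filter G) (f : T -> R[i]^o) (l : R[i]^o) :
  f @ G --> l <-> forall e : R, 0 < e -> \forall t \near G, normc (l - f t) < e.
Proof.
split=> [/cvgrPdist_lt h e e0|h].
  have : (0 : R[i]) < e%:C by rewrite ltcR.
  by move=> /h; apply: filterS => t; rewrite normcE0 ltcR.
apply/cvgrPdist_lt => e /gt0_complexE[r r0 ->].
by apply: filterS (h _ r0) => t; rewrite normcE0 ltcR.
Qed.

Lemma normc_dist z w : `|normc z - normc w| <= normc (z - w).
Proof. exact: (@ler_dist_dist R (Rcomplex R)). Qed.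

Lemma cvg_normc (T : Type) (G : set_system T) (FG : Filter G)
    (f : T -> R[i]^o) (l : R[i]^o) :
  f @ G --> l -> (normc (f t) : R) @[t --> G] --> (normc l : R).
Proof.
move=> /cvg_complexP fl; apply/cvgrPdist_lt => e e0.
by apply: filterS (fl _ e0) => t; exact/le_lt_trans/normc_dist.
Qed.

Lemma normc_continuous : continuous (fun z : R[i]^o => normc z : R).
Proof. by move=> z; apply: (cvg_normc (nbhs_filter z)); exact: cvg_id. Qed.

Lemma complex_complete F : ProperFilter F -> cauchy F -> cvg F.
Proof.
move=> FF /cauchy_ballP Fc.
have Fc' (g : R[i]^o -> R) (hg : forall z w, `|g z - g w| <= normc (z - w)) :
    cvg (g @ F).
  apply/cauchy_cvgP/cauchy_ballP => e e0; near_simpl.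
  have e0' : (0 : R[i]) < e%:C by rewrite ltcR.
  apply: filterS (Fc _ e0') => -[x y]; rewrite /= /ball /=.
  rewrite normcE0 ltcR; exact/le_lt_trans/hg.
have cR : cvg ((fun z : R[i]^o => complex.Re z) @ F).
  apply: Fc' => z w; apply: le_trans (normc_ge_Re0 _).
  by case: z w => ? ? [? ?].
have cI : cvg ((fun z : R[i]^o => complex.Im z) @ F).
  apply: Fc' => z w; apply: le_trans (normc_ge_Im _).
  by case: z w => ? ? [? ?].
have [x xP] := (cvg_ex _).1 cR; have [y yP] := (cvg_ex _).1 cI.
apply/cvg_ex; exists (x +i* y); apply/cvg_complexP => e e0.
move/cvgrPdist_lt: xP => /(_ _ (divr_gt0 e0 (ltr0n _ 2)))xP.
move/cvgrPdist_lt: yP => /(_ _ (divr_gt0 e0 (ltr0n _ 2)))yP.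
near=> z; apply: le_lt_trans (normc_le_ReIm _) _.
rewrite (splitr e) ltrD//.
  suff -> : complex.Re (x +i* y - z) = x - complex.Re z by near: z.
  by case: (z).
suff -> : complex.Im (x +i* y - z) = y - complex.Im z by near: z.
by case: (z).
Unshelve. all: by end_near. Qed.

End ComplexComplete.

Section ContinuousOperations.
Variables (R : realType) (T : topologicalType).
Implicit Types f g : T -> R[i]^o.

Lemma ctsD f g : continuous f -> continuous g -> continuous (fun x => f x + g x).
Proof. by move=> cf cg x; apply: cvgD; [exact: cf|exact: cg]. Qed.

Lemma ctsN f : continuous f -> continuous (fun x => - f x).
Proof. by move=> cf x; apply: cvgN; exact: cf. Qed.

Lemma ctsC (c : R[i]^o) : continuous (fun _ : T => c).
Proof. by move=> x; exact: cvg_cst. Qed.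

Lemma ctsM f g : continuous f -> continuous g ->
  continuous (fun x => f x * g x : R[i]^o).
Proof. by move=> cf cg x; apply: (@cvgZ _ R[i]^o); [exact: cf|exact: cg]. Qed.

Lemma cts_lim_unif (l : T -> R[i]^o) :
  (forall e : R, 0 < e -> exists f, continuous f /\
     forall x, normc (l x - f x) <= e) -> continuous l.
Proof.
move=> lu x; apply/cvg_complexP => e e0.
have e3 : 0 < e / 3 by rewrite divr_gt0.
have [f [cf fP]] := lu _ e3.
have /cvg_complexP/(_ _ e3) := cf x.
apply: filterS => y fxy.
rewrite (_ : l x - l y = (l x - f x) + ((f x - f y) + - (l y - f y))); last first.
  by rewrite opprB (addrA (f x - f y)) subrK addrA subrK.
have -> : e = e / 3 + (e / 3 + e / 3) by lra.
apply: le_lt_trans (normc_triangle _ _) _; rewrite ler_ltD//.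
by apply: le_lt_trans (normc_triangle _ _) _; rewrite normcN ltr_leD.
Qed.

End ContinuousOperations.

Section ContinuousFunctions.
Variables (R : realType) (a b : R).
Notation I := (set_type `[a, b]).
Notation C := (R[i]^o).

(* The subtype [set_type `[a, b]] carries the topology induced by that of R, and
   [R[i]^o] is R[i] seen as a normed module over itself.  The alias keeps the
   sup-norm topology apart from the library one on [continuousType]. *)
Definition Cab : Type := continuousType I C.

HB.instance Definition _ := Choice.copy Cab (continuousType I C).

Definition Cab_fun (f : Cab) : I -> C := @Continuous.sort I C f.
Coercion Cab_fun : Cab >-> Funclass.

Implicit Types (f g h : Cab) (k : R[i]).

Lemma Cab_continuous f : continuous f.
Proof. exact: (@cts_fun I C f). Qed.

Lemma CabP f g : (forall x, f x = g x) -> f = g.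
Proof. by move=> fg; apply/(@continuousEP I C). Qed.

Definition mkCab (f : I -> C) (cf : continuous f) : Cab :=
  HB.pack_for (continuousType I C) f (isContinuous.Build I C f cf).

Lemma Cab_add_subproof f g : continuous (fun x => f x + g x).
Proof. by apply: ctsD; exact: Cab_continuous. Qed.

Lemma Cab_opp_subproof f : continuous (fun x => - f x).
Proof. by apply: ctsN; exact: Cab_continuous. Qed.

Lemma Cab_cst_subproof (c : C) : continuous (fun _ : I => c).
Proof. exact: ctsC. Qed.

Lemma Cab_mul_subproof f g : continuous (fun x => f x * g x : C).
Proof. by apply: ctsM; exact: Cab_continuous. Qed.

Lemma Cab_scale_subproof k f : continuous (fun x => k * f x : C).
Proof. by apply: ctsM; [exact: ctsC|exact: Cab_continuous]. Qed.

Definition Cab_add f g := mkCab (@Cab_add_subproof f g).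
Definition Cab_opp f := mkCab (@Cab_opp_subproof f).
Definition Cab_zero := mkCab (@Cab_cst_subproof 0).
Definition Cab_scale k f := mkCab (@Cab_scale_subproof k f).
Definition Cab_mul f g := mkCab (@Cab_mul_subproof f g).

Lemma Cab_addA : associative Cab_add.
Proof. by move=> f g h; apply: CabP => x; exact: addrA. Qed.
Lemma Cab_addC : commutative Cab_add.
Proof. by move=> f g; apply: CabP => x; exact: addrC. Qed.
Lemma Cab_add0 : left_id Cab_zero Cab_add.
Proof. by move=> f; apply: CabP => x; exact: add0r. Qed.
Lemma Cab_addN : left_inverse Cab_zero Cab_opp Cab_add.
Proof. by move=> f; apply: CabP => x; exact: addNr. Qed.

HB.instance Definition _ :=
  GRing.isZmodule.Build Cab Cab_addA Cab_addC Cab_add0 Cab_addN.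

Lemma Cab_scaleA k l f : Cab_scale k (Cab_scale l f) = Cab_scale (k * l) f.
Proof. by apply: CabP => x; exact: mulrA. Qed.
Lemma Cab_scale1 : left_id 1 Cab_scale.
Proof. by move=> f; apply: CabP => x; exact: mul1r. Qed.
Lemma Cab_scaleDr : right_distributive Cab_scale +%R.
Proof. by move=> k f g; apply: CabP => x; exact: mulrDr. Qed.
Lemma Cab_scaleDl f : {morph Cab_scale^~ f : k l / k + l}.
Proof. by move=> k l; apply: CabP => x; exact: mulrDl. Qed.

HB.instance Definition _ := GRing.Zmodule_isLmodule.Build R[i] Cab
  Cab_scaleA Cab_scale1 Cab_scaleDr Cab_scaleDl.

Definition Cab_supnorm f : R := sup [set normc (f x) | x in [set: I]].

Lemma Cab_has_ubound f : has_ubound [set normc (f x) | x in [set: I]].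
Proof.
have [ab|ba] := leP a b; last first.
  exists 0 => y [x _ _]; have := set_mem (valP x).
  by rewrite /= in_itv /= => /andP[/le_trans h /h]; rewrite leNgt ba.
have cf : {within `[a, b], continuous (valL_ (0 : C) f)}.
  by apply/subspace_valL_continuousP'; exact: Cab_continuous.
have /(EVT_max ab)[c _ cP] : {within `[a, b],
    continuous (fun x => normc (valL_ (0 : C) f x) : R)}.
  move=> x; apply: (@continuous_comp (subspace `[a, b]) C R); first exact: cf.
  exact: normc_continuous.
exists (normc (valL_ (0 : C) f c)) => y [x _ <-].
have := cP (val x) (set_mem (valP x)).
have /(congr1 (@^~ x)) : sigL `[a, b] (valL_ (0 : C) f) = f by exact: valLK.
by rewrite /sigL /= => ->.
Qed.

Lemma Cab_supnorm_ge f x : normc (f x) <= Cab_supnorm f.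
Proof. by apply: ub_le_sup; [exact: Cab_has_ubound|exists x]. Qed.

Lemma Cab_supnorm_le f (r : R) : 0 <= r -> (forall x, normc (f x) <= r) ->
  Cab_supnorm f <= r.
Proof.
move=> r0 fr; have [E|ne] := eqVneq [set normc (f x) | x in [set: I]] set0.
  by rewrite /Cab_supnorm E sup0.
by apply: ge_sup; [exact/set0P|move=> y [x _ <-]].
Qed.

Lemma Cab_supnorm_ge0 f : 0 <= Cab_supnorm f.
Proof.
have [E|/set0P[y [x _ _]]] := eqVneq [set normc (f x) | x in [set: I]] set0.
  by rewrite /Cab_supnorm E sup0.
exact: le_trans (normc_ge0 (f x)) (Cab_supnorm_ge f x).
Qed.

(* Norms on normed modules over R[i] take their values in R[i]. *)
Definition Cab_norm f : R[i] := (Cab_supnorm f)%:C.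

Lemma Cab_normD f g : Cab_norm (f + g) <= Cab_norm f + Cab_norm g.
Proof.
rewrite -rmorphD lecR; apply: Cab_supnorm_le => [|x].
  by rewrite addr_ge0// Cab_supnorm_ge0.
by apply: le_trans (normc_triangle _ _) _; rewrite lerD// Cab_supnorm_ge.
Qed.

Lemma Cab_supnormZ_le k f : Cab_supnorm (k *: f) <= normc k * Cab_supnorm f.
Proof.
apply: Cab_supnorm_le => [|x]; first by rewrite mulr_ge0 ?normc_ge0 ?Cab_supnorm_ge0.
change (normc (k * f x) <= normc k * Cab_supnorm f).
by rewrite normcM ler_wpM2l ?normc_ge0 ?Cab_supnorm_ge.
Qed.

Lemma Cab_normZ k f : Cab_norm (k *: f) = `|k| * Cab_norm f.
Proof.
rewrite normcE0 -rmorphM; congr (_%:C); apply/le_anti.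
rewrite Cab_supnormZ_le /=; have [->|k0] := eqVneq k 0.
  by rewrite normc0 mul0r Cab_supnorm_ge0.
have nk0 : 0 < normc k.
  rewrite lt_neqAle normc_ge0 andbT eq_sym.
  by apply: contra k0 => /eqP/eq0_normc ->.
rewrite -ler_pdivlMl// -normcV.
by apply: le_trans (Cab_supnormZ_le _ _); rewrite scalerA mulVf// scale1r.
Qed.

Lemma Cab_norm0_eq0 f : Cab_norm f = 0 -> f = 0.
Proof.
move=> [f0]; apply: CabP => x; apply: eq0_normc; apply/le_anti.
by rewrite normc_ge0 andbT -f0 Cab_supnorm_ge.
Qed.

HB.instance Definition _ := Lmodule_isNormed.Build R[i] Cab
  Cab_normD Cab_normZ Cab_norm0_eq0.

Lemma Cab_normE f : `|f| = (Cab_supnorm f)%:C.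
Proof. by []. Qed.

Lemma Cab_complete (F : set_system Cab) : ProperFilter F -> cauchy F -> cvg F.
Proof.
move=> FF Fc; have /cauchy_ballP Fb := Fc.
have Fx x : cvg ((fun f : Cab => f x) @ F).
  apply: complex_complete; apply/cauchy_ballP => e e0; near_simpl.
  apply: filterS (Fb _ e0) => -[f g]; rewrite /= -!ball_normE /=.
  apply: le_lt_trans; rewrite normcE0 Cab_normE lecR.
  exact: (@Cab_supnorm_ge (f - g)).
pose l x : C := lim ((fun f : Cab => f x) @ F).
have lP x : (fun f : Cab => f x) @ F --> l x by exact: Fx.
have lu (e : R) : 0 < e -> F [set f : Cab | forall x, normc (l x - f x) <= e].
  move=> e0; have e2 : 0 < e / 2 by rewrite divr_gt0.
  have e20 : (0 : R[i]) < (e / 2)%:C by rewrite ltcR.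
  have := Fb _ e20; rewrite near_simpl => /nearP_dep.
  apply: filterS => f fP x.
  have /cvg_complexP/(_ _ e2) lx := lP x.
  have [g [/= fg lg]] := filter_ex (filterI fP lx).
  rewrite (_ : l x - f x = (l x - g x) + (g x - f x)); last by rewrite addrA subrK.
  apply: le_trans (normc_triangle _ _) _; rewrite (splitr e) lerD ?(ltW lg)//.
  move: fg; rewrite -ball_normE /= Cab_normE ltcR => /ltW; apply: le_trans.
  rewrite -normcN opprB; exact: (@Cab_supnorm_ge (f - g)).
have cl : continuous l.
  apply: cts_lim_unif => e e0; have [f fP] := filter_ex (lu _ e0).
  by exists f; split; [exact: Cab_continuous|exact: fP].
apply/cvg_ex; exists (mkCab cl); apply/cvgrPdist_lt => e /gt0_complexE[r r0 ->].
have r2 : 0 < r / 2 by rewrite divr_gt0.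
apply: filterS (lu _ r2) => f fP; rewrite Cab_normE ltcR.
apply: (@le_lt_trans _ _ (r / 2)); last by lra.
by apply: Cab_supnorm_le => [|x]; [exact: ltW|exact: fP].
Qed.

HB.instance Definition _ := Uniform_isComplete.Build Cab Cab_complete.

Lemma Cab_mulA : associative Cab_mul.
Proof. by move=> f g h; apply: CabP => x; exact: mulrA. Qed.
Lemma Cab_mulDl : left_distributive Cab_mul +%R.
Proof. by move=> f g h; apply: CabP => x; exact: mulrDl. Qed.
Lemma Cab_mulDr : right_distributive Cab_mul +%R.
Proof. by move=> f g h; apply: CabP => x; exact: mulrDr. Qed.
Lemma Cab_mulZl k f g : k *: Cab_mul f g = Cab_mul (k *: f) g.
Proof. by apply: CabP => x; exact: mulrA. Qed.
Lemma Cab_mulZr k f g : k *: Cab_mul f g = Cab_mul f (k *: g).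
Proof. by apply: CabP => x; exact: mulrCA. Qed.
Lemma Cab_normM f g : `|Cab_mul f g| <= `|f| * `|g|.
Proof.
rewrite !Cab_normE -rmorphM lecR; apply: Cab_supnorm_le => [|x].
  by rewrite mulr_ge0// Cab_supnorm_ge0.
change (normc (f x * g x) <= Cab_supnorm f * Cab_supnorm g).
by rewrite normcM ler_pM ?normc_ge0 ?Cab_supnorm_ge.
Qed.

HB.instance Definition _ := CompleteNormedModule_isBanachAlgebra.Build R[i] Cab
  Cab_mulA Cab_mulDl Cab_mulDr Cab_mulZl Cab_mulZr Cab_normM.

Lemma Cab_bmulE f g x : bmul f g x = f x * g x.
Proof. by []. Qed.

End ContinuousFunctions.

(* Main.v *)
Require Import Defs.
From HB Require Import structures.
From mathcomp Require Import all_boot all_order all_algebra.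
From mathcomp Require Import complex.
From mathcomp Require Import all_classical all_reals all_analysis.

(** A zero of f produces approximate annihilators.  The functions
    u_n = 1 / (1 + (n+1)|f|), called [damping f n] below, take values in ]0, 1]
    and equal 1 exactly where f vanishes, so they have norm 1 as soon as f has
    a zero ([damping_norm]), while |f u_n| = |f| / (1 + (n+1)|f|) <= 1 / (n+1)
    everywhere ([mul_damping_norm_le]).  Building u_n from |f| itself, rather
    than as a bump around the zero, makes this estimate hold pointwise without
    any appeal to the modulus of continuity of f.

    Conversely, if f vanishes nowhere then 1/f is again continuous, hence of
    finite norm by compactness of the interval, and f is invertible.  An
    invertible element z is never a topological divisor of zero, because
    |u| = |z^-1 (z u)| <= |z^-1| |z u| keeps z u away from 0 when |u| = 1
    ([invertible_not_topological_divisor_of_zero]). *)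

Set Implicit Arguments.
Unset Strict Implicit.
Unset Printing Implicit Defensive.
Import Order.TTheory GRing.Theory Num.Theory.
Import numFieldNormedType.Exports.
Local Open Scope classical_set_scope.
Local Open Scope complex_scope.
Local Open Scope ring_scope.

(** This serves both the left and the right alternative in the definition of
    a topological divisor of zero: y is z u or u z, and M is |z^-1|. *)
Lemma unit_norm_not_dominated (K : numFieldType) (V W : normedModType K)
    (M : K) (u : nat -> V) (y : nat -> W) :
  0 <= M -> (forall n, `|u n| = 1) -> (forall n, `|u n| <= M * `|y n|) ->
  ~ y n @[n --> \oo] --> (0 : W).
Proof.
move=> M0 u1 uy /cvgr0Pnorm_lt y0.
have M1 : 0 < M + 1 by rewrite ltr_wpDl.
have Mi : 0 < (M + 1)^-1 by rewrite invr_gt0.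
have [n yn] := filter_ex (y0 _ Mi).
have : 1 <= M * (M + 1)^-1.
  by rewrite -{1}(u1 n); apply: le_trans (uy n) _; rewrite ler_wpM2l// ltW.
by rewrite ler_pdivlMr// mul1r gerDl ler10.
Qed.

(** Algebras here need not have a unit, so invertibility of [z] is expressed by
    cancellation of multiplication by [z] through multiplication by [w]. *)
Lemma invertible_not_topological_divisor_of_zero (K : numFieldType)
    (A : banachAlgType K) (z w : A) :
  (forall x, bmul w (bmul z x) = x) -> (forall x, bmul (bmul x z) w = x) ->
  ~ topological_divisor_of_zero z.
Proof.
move=> wz zw [u [u1 [|]]]; apply: (unit_norm_not_dominated (normr_ge0 w) u1) => n.
- by rewrite -{1}(wz (u n)) normr_bmul_le.
- by rewrite -{1}(zw (u n)) mulrC normr_bmul_le.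
Qed.

Lemma continuous_inv (R : realType) (T : topologicalType) (g : T -> R[i]^o) :
  continuous g -> (forall x, g x != 0) ->
  continuous (fun x => (g x)^-1 : R[i]^o).
Proof. by move=> cg g0 x; apply: cvgV; [exact: g0|exact: cg]. Qed.

Section UniformNorm.
Variables (R : realType) (a b : R).
Implicit Types f : Cab a b.

Lemma Cab_norm_ge f x : `|f x| <= `|f|.
Proof. by rewrite Cab_normE normcE0 lecR Cab_supnorm_ge. Qed.

Lemma Cab_norm_le f (r : R[i]) : 0 <= r -> (forall x, `|f x| <= r) -> `|f| <= r.
Proof.
case: r => r s; rewrite lecE /= => /andP[/eqP -> r0] fr.
rewrite Cab_normE lecR; apply: Cab_supnorm_le => // x.
by rewrite -lecR -normcE0.
Qed.

Definition Cab_inv f (f0 : forall x, f x != 0) : Cab a b :=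
  mkCab (continuous_inv (@Cab_continuous _ _ _ f) f0).

Lemma Cab_mulKf f (f0 : forall x, f x != 0) g :
  bmul (Cab_inv f0) (bmul f g) = g.
Proof. by apply: CabP => x; exact: mulKf. Qed.

Lemma Cab_mulfK f (f0 : forall x, f x != 0) g :
  bmul (bmul g f) (Cab_inv f0) = g.
Proof. by apply: CabP => x; exact: mulfK. Qed.

Lemma damping_denom_gt0 f n x : 0 < 1 + n.+1%:R * `|f x|.
Proof. by rewrite ltr_wpDr// mulr_ge0. Qed.

Lemma damping_subproof f n :
  continuous (fun x => (1 + n.+1%:R * `|f x|)^-1 : R[i]^o).
Proof.
have cn : continuous (fun x => `|f x| : R[i]^o).
  by move=> x; exact: (cvg_norm (@Cab_continuous _ _ _ f x)).
apply: continuous_inv => [|x]; last by rewrite gt_eqF// damping_denom_gt0.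
by apply: ctsD; [exact: ctsC|apply: ctsM; [exact: ctsC|exact: cn]].
Qed.

Definition damping f n : Cab a b := mkCab (@damping_subproof f n).

Lemma damping_norm f n c : f c = 0 -> `|damping f n| = 1.
Proof.
move=> fc; apply/le_anti/andP; split.
  apply: Cab_norm_le => // x.
  change (`|(1 + n.+1%:R * `|f x|)^-1| <= 1).
  have d0 := damping_denom_gt0 f n x.
  by rewrite gtr0_norm ?invr_gt0// invf_le1// lerDl mulr_ge0.
have : `|damping f n c| = 1.
  change (`|(1 + n.+1%:R * `|f c|)^-1| = 1).
  by rewrite fc normr0 mulr0 addr0 invr1 normr1.
by move=> <-; exact: Cab_norm_ge.
Qed.

(** The bound is uniform because t / (1 + N t) <= 1 / N for all t >= 0. *)
Lemma mul_damping_norm_le f n : `|bmul f (damping f n)| <= n.+1%:R^-1.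
Proof.
apply: Cab_norm_le => [|x]; first by rewrite invr_ge0.
change (`|f x * (1 + n.+1%:R * `|f x|)^-1| <= n.+1%:R^-1).
have d0 := damping_denom_gt0 f n x.
rewrite normrM (gtr0_norm (_ : 0 < _^-1)) ?invr_gt0//.
by rewrite ler_pdivrMr// ler_pdivlMl// lerDr.
Qed.

End UniformNorm.

Theorem theorem2p2 (R : realType) (a b : R) (ab : a < b) (f : Cab a b) :
  topological_divisor_of_zero f <->
  exists c : set_type `[a, b], f c = 0.
Proof.
split=> [ftdz|[c fc]].
  have [//|nof] := pselect (exists c, f c = 0).
  have f0 x : f x != 0 by apply/eqP => fx; apply: nof; exists x.
  by have := invertible_not_topological_divisor_of_zero
    (Cab_mulKf f0) (Cab_mulfK f0) ftdz.
exists (damping f); split=> [n|]; first exact: damping_norm fc.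
left; apply/cvgr0Pnorm_lt => e /gt0_complexE[r r0 ->].
near=> n; apply: le_lt_trans (mul_damping_norm_le f n) _.
suff : (n.+1%:R^-1 : R) < r by rewrite -ltcR fmorphV rmorph_nat.
by near: n; exact: near_infty_natSinv_lt (PosNum r0).
Unshelve. all: by end_near. Qed.
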